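(* Let $a,b$ be real numbers with $1<a<b$. Then $$\pi=\frac83\,b^4\,\frac{\mathbb{K}+\mathbb{E}}{\mathbb{F}},$$ where $$\mathbb{K}=\frac{b^4-b^2+1}{b^2-1}\,K\!\left(\frac{(a^2-1)b}{a(b^2-1)}\right)-\frac{b^4+b^2+1}{1+b^2}\,K\!\left(\frac{(a^2+1)b}{a(1+b^2)}\right),$$ $$\mathbb{E}=(1-b^2)\,E\!\left(\frac{(a^2-1)b}{a(b^2-1)}\right)+(1+b^2)\,E\!\left(\frac{(a^2+1)b}{a(1+b^2)}\right),$$ $$\mathbb{F}=F_D^{(3)}\!\left(\tfrac52;\tfrac12,\tfrac12,\tfrac12;3\,\Big|\,\frac{a^2}{b^2},\frac1{a^2b^2},\frac1{b^4}\right).$$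
   Context: $K(k)=\int_0^1\frac{dx}{\sqrt{(1-x^2)(1-k^2x^2)}}$ and $E(k)=\int_0^1\sqrt{\frac{1-k^2x^2}{1-x^2}}\,dx$ are the complete elliptic integrals of the first and second kind, as functions of the modulus $k$. The Lauricella function of $n$ variables is $F_D^{(n)}(\alpha;\beta_1,\dots,\beta_n;\gamma\,|\,x_1,\dots,x_n)=\sum_{m_1,\dots,m_n\ge0}\frac{(\alpha)_{m_1+\cdots+m_n}(\beta_1)_{m_1}\cdots(\beta_n)_{m_n}}{(\gamma)_{m_1+\cdots+m_n}\,m_1!\cdots m_n!}x_1^{m_1}\cdots x_n^{m_n}$ for $|x_j|<1$, with $(x)_k$ the Pochhammer symbol. For $\operatorname{Re}\gamma>\operatorname{Re}\alpha>0$ it equals, and outside the region of convergence is defined by analytic continuation through, $\frac{\Gamma(\gamma)}{\Gamma(\alpha)\Gamma(\gamma-\alpha)}\int_0^1\frac{u^{\alpha-1}(1-u)^{\gamma-\alpha-1}}{(1-x_1u)^{\beta_1}\cdots(1-x_nu)^{\beta_n}}\,du$ (principal branches, $x_j\notin[1,\infty)$). *)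

(* Defs.v *)
From HB Require Import structures.
From mathcomp Require Import all_boot all_order all_algebra.
From mathcomp Require Import all_classical all_reals all_analysis.
Import Order.TTheory GRing.Theory Num.Theory.
Import numFieldNormedType.Exports.

Set Implicit Arguments.
Unset Strict Implicit.
Unset Printing Implicit Defensive.

Local Open Scope classical_set_scope.
Local Open Scope ring_scope.

(* Complete elliptic integrals, as functions of the modulus k, for |k| < 1.
   The integrands are nonnegative on [0, 1], so the Lebesgue integral is the
   improper Riemann integral; the value of the integrands at x = 1, where
   MathComp's 0^-1 = 0 is used, does not matter. *)
Definition ellipticK (R : realType) (k : R) : R :=
  \int[lebesgue_measure]_(x in `[0, 1])
    (Num.sqrt ((1 - x ^+ 2) * (1 - k ^+ 2 * x ^+ 2)))^-1.

Definition ellipticE (R : realType) (k : R) : R :=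
  \int[lebesgue_measure]_(x in `[0, 1])
    Num.sqrt ((1 - k ^+ 2 * x ^+ 2) / (1 - x ^+ 2)).

Definition pochhammer (R : realType) (x : R) (k : nat) : R :=
  \prod_(i < k) (x + i%:R).

Definition lauricellaD_term (R : realType) (n : nat) (alpha : R)
    (beta : n.-tuple R) (gamma : R) (x : n.-tuple R) (m : n.-tuple nat) : R :=
  let N := (\sum_(i < n) tnth m i)%N in
  pochhammer alpha N / pochhammer gamma N *
  \prod_(i < n) (pochhammer (tnth beta i) (tnth m i) / (tnth m i)`!%:R
                 * tnth x i ^+ tnth m i).

(* Unordered sum of an absolutely summable real family, as the difference of
   the sums of its positive and negative parts (it is a junk value if the family
   is not absolutely summable). *)
Definition unordered_sum (R : realType) (I : choiceType) (f : I -> R) : R :=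
  fine (\esum_(i in [set: I]) (EFin \o f)^\+ i
        - \esum_(i in [set: I]) (EFin \o f)^\- i)%E.

(* Lauricella's F_D in n variables, for real parameters and |x_j| < 1, where
   the multiple series converges absolutely; gamma must not be a nonpositive
   integer. *)
Definition lauricellaD (R : realType) (n : nat) (alpha : R)
    (beta : n.-tuple R) (gamma : R) (x : n.-tuple R) : R :=
  unordered_sum (lauricellaD_term alpha beta gamma x).

(* Main.v *)
Require Import Defs.
From HB Require Import structures.
From mathcomp Require Import all_boot all_order all_algebra.
From mathcomp Require Import all_classical all_reals all_analysis.
From mathcomp Require Import measurable_realfun ring lra.
Import Order.TTheory GRing.Theory Num.Theory.
Import numFieldNormedType.Exports.

Set Implicit Arguments.
Unset Strict Implicit.
Unset Printing Implicit Defensive.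

Local Open Scope classical_set_scope.
Local Open Scope ring_scope.

(** Why the formula holds.  Write S = sin t and
      P(t) = (b^4 - S^2) (b^2 - a^2 S^2) (b^2 - S^2 / a^2).

    The Lauricella series.  Since F_D has all its beta_j equal to 1/2, its
    coefficients are those of the expansion of (1 - z)^(-1/2), and the ratio
    (5/2)_N / (3)_N is a Wallis integral of sin^(2N+4).  Summing under the
    integral sign gives (lauricellaD_integral)
      F = 16 / (3 pi) * int_0^(pi/2) S^4 prod_j (1 - x_j S^2)^(-1/2) dt,
    and for the arguments of the theorem the product is b^4 / sqrt(P).
    This is Euler's integral after u = sin^2 t.

    The elliptic integrals.  The three arguments satisfy x_1 x_2 = x_3, so the
    curve of genus 2 behind the last integral has the extra involution
    u |-> b^4 / u, and its periods split into elliptic ones.  Concretely, for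
    e = 1 and e = -1 the Landen-type map
      y = (b^2 - e) S / (b^2 - e S^2)
    sends [0, pi/2] increasingly onto [0, 1] and turns K and E, at the two
    moduli of the theorem, into integrals over [0, pi/2] of rational functions
    of S^2 divided by the same radical sqrt(P) (ellipticK_landen,
    ellipticE_landen).

    The comparison.  The combination KK + EE of these integrands differs from
    2 S^4 / sqrt(P) by the derivative of
      2 sin t cos t sqrt(P) / (b^4 - S^4),
    which vanishes at both ends (boundary_derive, elliptic_combination).
    Hence KK + EE = 2 J and F = 16 b^4 J / (3 pi) for the same J > 0, and J
    cancels in the quotient. *)

(** * Differentiation of functions given by explicit formulas *)

(** The rules are restated for functions written pointwise, so that the shape of
    a formula alone determines which rule applies. *)
Section Derivation.
Context {R : realType}.
Implicit Types (f g : R -> R) (x df dg k : R).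

Lemma is_derive_continuous f x df :
  is_derive x 1 f df -> {for x, continuous f}.
Proof.
by case=> dF _; apply: differentiable_continuous; exact/derivable1_diffP.
Qed.

Lemma der_id x : is_derive x 1 (fun t : R => t) 1.
Proof. exact: is_derive_id. Qed.

Lemma der_cst x k : is_derive x 1 (fun _ : R => k) 0.
Proof. exact: is_derive_cst. Qed.

Lemma derD f g x df dg : is_derive x 1 f df -> is_derive x 1 g dg ->
  is_derive x 1 (fun t => f t + g t) (df + dg).
Proof. exact: is_deriveD. Qed.

Lemma derN f x df : is_derive x 1 f df -> is_derive x 1 (fun t => - f t) (- df).
Proof. exact: is_deriveN. Qed.

Lemma derM f g x df dg : is_derive x 1 f df -> is_derive x 1 g dg ->
  is_derive x 1 (fun t => f t * g t) (df * g x + f x * dg).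
Proof.
move=> hf hg; have := is_deriveM hf hg; rewrite /GRing.scale/= => h.
by apply: is_derive_eq h _; rewrite addrC mulrC.
Qed.

Lemma derX f x df n : is_derive x 1 f df ->
  is_derive x 1 (fun t => f t ^+ n) (n%:R * f x ^+ n.-1 * df).
Proof.
move=> hf; elim: n => [|n IH].
  by rewrite !mul0r; apply: der_cst.
rewrite (_ : (fun t => _) = (fun t => f t * f t ^+ n)); last first.
  by apply/funext => t; rewrite exprS.
apply: is_derive_eq (derM hf IH) _.
by case: n IH => [|n] _ /=; rewrite ?exprS -?[n.+2%:R]natr1; ring.
Qed.

Lemma der_comp (h : R -> R) f x dh df : is_derive (f x) 1 h dh ->
  is_derive x 1 f df -> is_derive x 1 (fun t => h (f t)) (dh * df).
Proof. by move=> hh hf; exact: is_derive1_comp. Qed.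

Lemma der_sin x : is_derive x 1 (@sin R) (cos x).
Proof. exact: is_derive_sin. Qed.

Lemma der_cos x : is_derive x 1 (@cos R) (- sin x).
Proof. exact: is_derive_cos. Qed.

Lemma derV f x df : f x != 0 -> is_derive x 1 f df ->
  is_derive x 1 (fun t => (f t)^-1) (- df / f x ^+ 2).
Proof.
move=> fx0 hf; have h := is_deriveV fx0 hf.
by apply: is_derive_eq h _; rewrite /GRing.scale/= !mulNr mulrC.
Qed.

Lemma der_sqrt f x df : 0 < f x -> is_derive x 1 f df ->
  is_derive x 1 (fun t => Num.sqrt (f t)) (df / (2 * Num.sqrt (f x))).
Proof.
move=> fx0 hf.
by rewrite mulrC; apply: der_comp => //; exact: is_derive1_sqrt.
Qed.

End Derivation.

(** The recursion, rather than class resolution, treats the premises: the latter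
    would try to unfold the real constants occurring in the formulas. *)
Ltac derive := repeat lazymatch goal with
  | |- is_derive _ _ (fun _ => ?k) _ => notypeclasses refine (der_cst _ k)
  | |- is_derive _ _ (fun t => t) _ => notypeclasses refine (der_id _)
  | |- is_derive _ _ (fun t => sin t) _ => notypeclasses refine (der_sin _)
  | |- is_derive _ _ (fun t => cos t) _ => notypeclasses refine (der_cos _)
  | |- is_derive _ _ (fun t => @?f t + @?g t) _ =>
      notypeclasses refine (derD (f := f) (g := g) _ _)
  | |- is_derive _ _ (fun t => - @?f t) _ =>
      notypeclasses refine (derN (f := f) _)
  | |- is_derive _ _ (fun t => @?f t * @?g t) _ =>
      notypeclasses refine (derM (f := f) (g := g) _ _)
  | |- is_derive _ _ (fun t => (@?f t)^-1) _ =>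
      notypeclasses refine (derV (f := f) _ _)
  | |- is_derive _ _ (fun t => Num.sqrt (@?f t)) _ =>
      notypeclasses refine (der_sqrt (f := f) _ _)
  | |- is_derive _ _ (fun t => @?f t ^+ ?n) _ =>
      notypeclasses refine (derX (f := f) n _)
  end.

(** Continuity of a formula is read off from its differentiability. *)
Ltac smooth := notypeclasses refine (is_derive_continuous _); derive.

Ltac derive_eq := notypeclasses refine (is_derive_eq _ _); [derive|].

(** * Fundamental theorem of calculus and improper substitution *)

Lemma continuous_at_within (R : realType) (a b : R) (f : R -> R) :
  (forall x, a <= x <= b -> {for x, continuous f}) ->
  {within `[a, b], continuous f}.
Proof.
by move=> cf; apply: continuous_in_subspaceT => x /[!inE]/= /[!in_itv]/=; exact: cf.
Qed.

Lemma is_derive_LRcontinuous (R : realType) (F f : R -> R) (a b : R) :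
  (forall x : R, is_derive x 1 F (f x)) -> derivable_oo_LRcontinuous F a b.
Proof.
move=> dF; have cF x : {for x, continuous F} by exact: is_derive_continuous.
split; first by move=> x _; exact: ex_derive.
- exact: cvg_at_right_filter (cF a).
- exact: cvg_at_left_filter (cF b).
Qed.

Lemma is_derive_derive1 (R : realType) (F f : R -> R) :
  (forall x : R, is_derive x 1 F (f x)) -> derive1 F = f.
Proof. by move=> dF; apply/funext => x; rewrite derive1E derive_val. Qed.

Lemma continuous_integrable_itv (R : realType) (a b : R) (f : R -> R) :
  continuous f -> lebesgue_measure.-integrable `[a, b] (EFin \o f).
Proof.
move=> cf; apply: continuous_compact_integrable; first exact: segment_compact.
exact: continuous_subspaceT.
Qed.

Lemma Rintegral_is_derive (R : realType) (a b : R) (F f : R -> R) : a < b ->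
  continuous f -> (forall x : R, is_derive x 1 F (f x)) ->
  \int[lebesgue_measure]_(x in `[a, b]) f x = F b - F a.
Proof.
move=> ab cf dF; rewrite /Rintegral (@continuous_FTC2 _ f F a b)//.
- exact: continuous_subspaceT.
- exact: is_derive_LRcontinuous dF.
- by rewrite (is_derive_derive1 dF).
Qed.

Lemma itv_bigcup_cvg (R : realType) (a b : R) (u : R^nat) :
  (forall n, u n < b) -> u @ \oo --> b ->
  `[a, b[%classic = \bigcup_n `[a, u n]%classic.
Proof.
move=> ub ucvg; apply/seteqP; split => [x /= | x [n _] /=]; rewrite !in_itv/=.
  move=> /andP[ax xb]; have [N _ uN] := cvgr_gt _ ucvg _ xb.
  by exists N => //=; rewrite in_itv/= ax/= ltW//; exact: uN (leqnn N).
by move=> /andP[-> /le_lt_trans]; exact.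
Qed.

(** The function G may blow up at F b, so the substitution rule for continuous
    functions only applies on the segments [a, t_n] with t_n increasing to b;
    monotone convergence on both sides then reaches b.  The transformed
    integrand is supplied as a continuous H agreeing with G (F x) * f x before
    b, because at b itself that product is typically of the form 0^-1 * 0. *)
Lemma improper_substitution (R : realType) (a b : R) (F f G H : R -> R) :
  a < b -> (forall x : R, is_derive x 1 F (f x)) -> continuous f ->
  (forall x, a <= x < b -> 0 < f x) ->
  (forall y, F a <= y < F b -> {for y, continuous G}) ->
  (forall y, 0 <= G y) -> continuous H ->
  (forall x, a <= x < b -> G (F x) * f x = H x) ->
  \int[lebesgue_measure]_(y in `[F a, F b]) G y =
  \int[lebesgue_measure]_(x in `[a, b]) H x.
Proof.
move=> ab dF cf f0 cG G0 cH GH; congr fine.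
have cF : continuous F by move=> x; exact: is_derive_continuous.
have F'f := is_derive_derive1 dF.
have incrF : {in `[a, b] &, {homo F : x y / x < y}}.
  apply: gtr0_derive1_lt_cc.
  - by move=> x _; exact: ex_derive.
  - move=> x; rewrite in_itv/= F'f => /andP[ax xb].
    by apply: f0; rewrite xb ltW.
  - exact: continuous_subspaceT.
pose t n : R := b - (b - a) / n.+2%:R.
have ba0 : 0 < b - a by rewrite subr_gt0.
have tb n : t n < b by rewrite /t ltrBlDr ltrDl divr_gt0.
have ta n : a < t n.
  by rewrite /t ltrBrDr -ltrBrDl ltr_pdivrMr// ltr_pMr// ltr1n.
have tab n : t n \in `[a, b] by rewrite in_itv/= !ltW.
have bab : b \in `[a, b] by rewrite in_itv/= lexx ltW.
have tnd : {homo t : m n / (m <= n)%N >-> m <= n}.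
  move=> m n mn; rewrite /t lerD2l lerN2 ler_pM2l// lef_pV2 ?posrE//.
  by rewrite ler_nat.
have tcvg : t @ \oo --> b.
  rewrite -[X in _ --> X]subr0; apply: cvgB; first exact: cvg_cst.
  rewrite -[X in _ --> X](mulr0 (b - a)); apply: cvgM; first exact: cvg_cst.
  by have := @cvg_harmonic R; rewrite -cvg_shiftS.
have Ftb n : F (t n) < F b by apply: incrF.
have Ftnd : {homo F \o t : m n / (m <= n)%N >-> m <= n}.
  move=> m n /tnd; rewrite le_eqVlt => /predU1P[/= ->//|/incrF/ltW]; exact.
have Ftcvg : (F \o t) @ \oo --> F b.
  by apply: continuous_cvg => //; exact: cF.
have cGF n : {within `[F a, F (t n)], continuous G}.
  apply: continuous_at_within => y /andP[Fay yFt]; apply: cG.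
  by rewrite Fay (le_lt_trans yFt).
have H0 x : a <= x < b -> 0 <= H x.
  by move=> xab; rewrite -GH// mulr_ge0// ltW// f0.
have eqn n : (\int[lebesgue_measure]_(y in `[F a, (F \o t) n]) (G y)%:E =
    \int[lebesgue_measure]_(x in `[a, t n]) (H x)%:E)%E.
  rewrite /comp (@integration_by_substitution_increasing _ F G a (t n))//.
  - apply: eq_integral => x /[!inE]/= /[!in_itv]/= /andP[ax xt].
    by rewrite F'f !fctE GH// ax (le_lt_trans xt).
  - exact: ltW.
  - move=> x y /[!in_itv]/= /andP[ax xt] /andP[ay yt].
    apply: incrF; rewrite in_itv/=.
      by rewrite ax (le_trans xt)// ltW.
    by rewrite ay (le_trans yt)// ltW.
  - by rewrite F'f => x _; exact: cf.
  - by rewrite F'f; apply/cvg_ex; exists (f a); exact: cvg_at_right_filter (cf a).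
  - rewrite F'f; apply/cvg_ex; exists (f (t n)).
    exact: cvg_at_left_filter (cf (t n)).
  - exact: is_derive_LRcontinuous dF.
have exhaust (c d : R) (u : R^nat) (g : R -> R) :
    (forall n, u n < d) -> u @ \oo --> d ->
    {homo u : m n / (m <= n)%N >-> m <= n} ->
    (forall n, {within `[c, u n], continuous g}) ->
    (forall x, c <= x < d -> 0 <= g x) ->
    (\int[lebesgue_measure]_(x in `[c, u n]) (g x)%:E @[n --> \oo] -->
     \int[lebesgue_measure]_(x in `[c, d]) (g x)%:E)%E.
  move=> ud ucvg und cg g0.
  have mg n : measurable_fun `[c, u n] g.
    exact: subspace_continuous_measurable_fun.
  rewrite -integral_itv_bndo_bndc; last first.
    apply/measurable_EFinP; rewrite (itv_bigcup_cvg c ud ucvg).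
    by apply/measurable_fun_bigcup => n; [exact: measurable_itv|exact: mg].
  rewrite (itv_bigcup_cvg c ud ucvg).
  apply: ge0_nondecreasing_set_cvg_integral => //.
  - move=> m n mn; apply/subsetPset; apply: subset_itvl.
    by rewrite bnd_simp; exact: und.
  - by move=> n; apply/measurable_EFinP; exact: mg.
  - move=> n x /=; rewrite in_itv/= lee_fin => /andP[cx xu].
    by apply: g0; rewrite cx (le_lt_trans xu).
have cHab n : {within `[a, t n], continuous H} by exact: continuous_subspaceT.
apply: cvg_unique (exhaust _ _ _ _ tb tcvg tnd cHab H0) => //.
by rewrite -(funext eqn); exact: exhaust.
Qed.

(** * Coefficients of the inverse square root, and Wallis integrals *)

Lemma pochhammerS (R : realType) (x : R) k :
  pochhammer x k.+1 = pochhammer x k * (x + k%:R).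
Proof. by rewrite /pochhammer big_ord_recr. Qed.

(** The m-th coefficient of the power series of (1 - z)^(-1/2), that is
    binomial(2m, m) / 4^m. *)
Definition invsqrt_coef (R : realType) (m : nat) : R :=
  pochhammer (1 / 2) m / m`!%:R.

Lemma invsqrt_coef0 (R : realType) : invsqrt_coef R 0 = 1.
Proof. by rewrite /invsqrt_coef /pochhammer big_ord0 fact0 divr1. Qed.

Lemma invsqrt_coefS (R : realType) m :
  m.+1%:R * invsqrt_coef R m.+1 = (1 / 2 + m%:R) * invsqrt_coef R m.
Proof.
rewrite /invsqrt_coef pochhammerS factS natrM.
by field; rewrite !pnatr_eq0 -lt0n fact_gt0 /= addrC natr1 pnatr_eq0.
Qed.

Lemma invsqrt_coef_gt0 (R : realType) m : 0 < invsqrt_coef R m.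
Proof.
by rewrite divr_gt0 ?ltr0n ?fact_gt0// prodr_gt0.
Qed.

Lemma invsqrt_coef_ge0 (R : realType) m : 0 <= invsqrt_coef R m.
Proof. exact/ltW/invsqrt_coef_gt0. Qed.

Lemma invsqrt_coef_le1 (R : realType) m : invsqrt_coef R m <= 1.
Proof.
elim: m => [|m IH]; first by rewrite invsqrt_coef0.
have m0 : 0 < m.+1%:R :> R by rewrite ltr0n.
rewrite -(ler_pM2l m0) invsqrt_coefS mulr1 -natr1.
have c0 : 0 <= 1 / 2 + m%:R :> R by rewrite addr_ge0// divr_ge0.
apply: le_trans (ler_wpM2l c0 IH) _; rewrite mulr1; lra.
Qed.

(** Wallis' recurrence: the derivative of - cos t sin^(2n+1) t is
    (2n+2) sin^(2n+2) t - (2n+1) sin^(2n) t, and the primitive vanishes at 0 and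
    at pi/2. *)
Lemma integral_sin_even (R : realType) n :
  \int[lebesgue_measure]_(x in `[0, pi / 2 : R]) sin x ^+ n.*2 =
  pi / 2 * invsqrt_coef R n.
Proof.
have pi0 : 0 < pi / 2 :> R by rewrite divr_gt0// pi_gt0.
have csinX m : continuous (fun x : R => sin x ^+ m).
  by move=> x; smooth.
elim: n => [|n IH].
  rewrite invsqrt_coef0 mulr1.
  rewrite (@Rintegral_is_derive _ _ _ id)// ?subr0//.
have n0 : n.+1.*2%:R != 0 :> R by rewrite pnatr_eq0.
apply: (mulfI n0).
set W := \int[_]_(x in _) _ in IH *; set W' := \int[_]_(x in _) _.
have -> : n.+1.*2%:R * W' = n.*2.+1%:R * W.
  apply/eqP; rewrite -subr_eq0; apply/eqP.
  rewrite /W /W' -!RintegralZl//=; [|exact: continuous_integrable_itv..].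
  rewrite -RintegralB//=; [|apply: continuous_integrable_itv => x;
    by smooth..].
  have dF (x : R) : is_derive x 1 (fun t => - (cos t * sin t ^+ n.*2.+1))
      (n.+1.*2%:R * sin x ^+ n.+1.*2 - n.*2.+1%:R * sin x ^+ n.*2).
    derive_eq.
    have := cos2sin2 x; move: (cos x) (sin x) => c s c2.
    rewrite /= [LHS](_ : _ = s ^+ n.*2 * (s ^+ 2 - n.*2.+1%:R * c ^+ 2)).
      by rewrite c2 doubleS !exprS -![_.+1%:R]natr1; ring.
    by rewrite exprS; ring.
  rewrite (Rintegral_is_derive pi0 _ dF).
    by rewrite cos_pihalf sin0 expr0n/= mul0r mulr0 subrr.
  by move=> x; smooth.
rewrite IH -[n.+1.*2]muln2 -[n.*2]muln2.
have := invsqrt_coefS R n; move: (invsqrt_coef _ n.+1) (invsqrt_coef _ n) => u v.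
rewrite -[(n * 2).+1%:R]natr1 !natrM -[n.+1%:R]natr1 => uv.
have -> : (n%:R + 1) * 2 * (pi / 2 * u) = pi * ((n%:R + 1) * u) by field.
by rewrite uv; field.
Qed.

(** Since (5/2)_N = (1/2)_(N+2) / ((1/2) (3/2)) and (3)_N = (N+2)! / 2, this ratio
    is a Wallis integral up to a constant. *)
Lemma pochhammer_ratio (R : realType) N :
  pochhammer (5 / 2) N / pochhammer 3 N = 8 / 3 * invsqrt_coef R N.+2.
Proof.
elim: N => [|N IH].
  rewrite /invsqrt_coef !pochhammerS /pochhammer !big_ord0 !factS fact0.
  by field.
rewrite !pochhammerS invfM mulrACA IH.
have N0 : 3 + N%:R != 0 :> R by rewrite -natrD pnatr_eq0.
apply: (mulIf N0); rewrite -[LHS]mulrA divfK// -[LHS]mulrA -[RHS]mulrA.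
have -> : 3 + N%:R = N.+3%:R :> R by rewrite -natrD.
rewrite [X in _ = _ * X]mulrC invsqrt_coefS; congr (_ * _); rewrite mulrC.
by congr (_ * _); rewrite -!natr1; field.
Qed.

(** * The binomial series of the inverse square root *)

(** This is n r^n <= 1 + r + ... + r^(n-1) with the geometric sum evaluated. *)
Lemma natmul_expr_le (R : realType) (r : R) n : 0 <= r <= 1 ->
  n%:R * r ^+ n * (1 - r) <= 1 - r ^+ n.
Proof.
move=> /andP[r0 r1]; elim: n => [|n IH]; first by rewrite !mul0r expr0 subrr.
have rn0 : 0 <= r ^+ n by exact: exprn_ge0.
have rn1 : r ^+ n <= 1 by exact: exprn_ile1.
rewrite exprS -natr1; move: (r ^+ n) (n%:R) rn0 rn1 IH => p k p0 p1 IH.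
have h1 : 0 <= r * (1 - p - k * p * (1 - r)) by rewrite mulr_ge0// subr_ge0.
have h2 : 0 <= (1 - r) * (1 - r * p).
  by rewrite mulr_ge0 ?subr_ge0// mulr_ile1.
by rewrite -subr_ge0; apply: le_trans (addr_ge0 h1 h2) _; rewrite le_eqVlt;
  apply/orP; left; apply/eqP; ring.
Qed.

(** With r = sqrt z, the term n z^n = (n r^n) r^n is bounded by a constant times
    r^n. *)
Lemma cvg_natmul_expr (R : realType) (z : R) : 0 <= z < 1 ->
  n%:R * z ^+ n @[n --> \oo] --> (0 : R).
Proof.
move=> /andP[z0 z1]; pose r := Num.sqrt z.
have zE : z = r ^+ 2 by rewrite sqr_sqrtr.
have r0 : 0 <= r by exact: sqrtr_ge0.
have r1 : r < 1 by rewrite /r -[ltRHS]sqrtr1 ltr_sqrt.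
have br0 : 0 < 1 - r by rewrite subr_gt0.
have bound n : n%:R * z ^+ n <= (1 - r)^-1 * r ^+ n.
  rewrite zE exprAC expr2 mulrA ler_wpM2r ?exprn_ge0//.
  rewrite -[leRHS]div1r ler_pdivlMr// (le_trans (natmul_expr_le _ _))//.
    by rewrite r0 ltW.
  by rewrite gerBl exprn_ge0.
apply: (@squeeze_cvgr _ _ _ _ (cst 0) (fun n => (1 - r)^-1 * r ^+ n)).
- by apply: nearW => n; rewrite bound mulr_ge0 ?exprn_ge0.
- exact: cvg_cst.
- by apply: (@cvg_geometric _ (1 - r)^-1 r); rewrite ger0_norm.
Qed.

(** The full series solves (1 - x) P' = P / 2; a partial sum solves it up to the
    single monomial left over by the recurrence on the coefficients. *)
Lemma invsqrt_partial_sum_der (R : realType) N (x : R) : x < 1 ->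
  is_derive x 1 (fun t => \sum_(0 <= m < N) invsqrt_coef R m * t ^+ m)
    ((1 / 2 * (\sum_(0 <= m < N) invsqrt_coef R m * x ^+ m)
      - N%:R * invsqrt_coef R N * x ^+ N.-1) / (1 - x)).
Proof.
move=> x1; have x0 : 1 - x != 0 by rewrite gt_eqF// subr_gt0.
elim: N => [|N IH].
  rewrite (_ : (fun t => _) = cst 0); last by apply/funext => t; rewrite big_nil.
  by apply: is_derive_eq (der_cst _ _) _; rewrite big_nil; ring.
rewrite (_ : (fun t => _) = fun t => \sum_(0 <= m < N) invsqrt_coef R m * t ^+ m
    + invsqrt_coef R N * t ^+ N); last first.
  by apply/funext => t; rewrite big_nat_recr.
apply: is_derive_eq (derD IH (derM (der_cst _ _) (derX N (der_id _)))) _.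
rewrite big_nat_recr//= invsqrt_coefS.
case: N {IH} => [|N] /=; first by rewrite big_nil; field.
by rewrite exprS; field.
Qed.

(** The product g(t) = sqrt(1 - t) P(t) has g(0) = 1, and by the previous equation
    its derivative reduces to one small term, which the mean value theorem turns
    into an estimate of 1 - g(z). *)
Lemma invsqrt_partial_sum_bound (R : realType) N (z : R) : 0 <= z < 1 ->
  `|1 - Num.sqrt (1 - z) * \sum_(0 <= m < N.+1) invsqrt_coef R m * z ^+ m|
  <= N.+1%:R * z ^+ N.+1 / Num.sqrt (1 - z).
Proof.
move=> /andP[z0 z1].
pose P (t : R) := \sum_(0 <= m < N.+1) invsqrt_coef R m * t ^+ m.
pose g t := Num.sqrt (1 - t) * P t.
pose dg (t : R) := - (N.+1%:R * invsqrt_coef R N.+1 * t ^+ N / Num.sqrt (1 - t)).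
have gder (t : R) : t < 1 -> is_derive t 1 g (dg t).
  move=> t1; have ht : 0 < 1 - t by rewrite subr_gt0.
  have hP := invsqrt_partial_sum_der N.+1 t1.
  have hs : is_derive t 1 (fun u => Num.sqrt (1 - u))
      ((0 + - 1) / (2 * Num.sqrt (1 - t))).
    by apply: der_sqrt => //; derive.
  apply: is_derive_eq (derM hs hP) _.
  rewrite /dg -/(P t) /= -[in X in _ / X](sqr_sqrtr (ltW ht)).
  have : Num.sqrt (1 - t) != 0 by rewrite gt_eqF// sqrtr_gt0.
  by move: (Num.sqrt _) => s s0; field.
have g0 : g 0 = 1.
  rewrite /g /P subr0 sqrtr1 mul1r big_nat_recl//= expr0 invsqrt_coef0 mulr1.
  by rewrite big1 ?addr0// => m _; rewrite expr0n/= mulr0.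
have [||c] := @MVT_segment _ g dg 0 z z0.
- by move=> x; rewrite in_itv/= => /andP[_ xz]; exact: gder (lt_trans xz z1).
- apply: continuous_at_within => x /andP[_ xz].
  exact: is_derive_continuous (gder _ (le_lt_trans xz z1)).
rewrite in_itv/= g0 subr0 -/(P z) -/(g z) distrC => /andP[c0 cz] ->.
have sz : 0 < Num.sqrt (1 - z) by rewrite sqrtr_gt0 subr_gt0.
have sc : Num.sqrt (1 - z) <= Num.sqrt (1 - c).
  by rewrite ler_sqrt ?subr_ge0 ?(ltW (le_lt_trans cz _))// lerD2l lerN2.
have c1 : c <= 1 by rewrite (le_trans cz)// ltW.
have cN0 : 0 <= c ^+ N by exact: exprn_ge0.
have coef0 := invsqrt_coef_ge0 R N.+1.
rewrite normrM (ger0_norm z0) /dg normrN ger0_norm; last first.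
  by rewrite divr_ge0 ?sqrtr_ge0// mulr_ge0// mulr_ge0.
rewrite mulrAC ler_pM ?invr_ge0 ?sqrtr_ge0//.
- by rewrite mulr_ge0// mulr_ge0// mulr_ge0.
- rewrite exprSr mulrA ler_wpM2r// ler_pM//; first exact: mulr_ge0.
    by rewrite ler_piMr// invsqrt_coef_le1.
  by rewrite lerXn2r ?nnegrE.
- by rewrite lef_pV2 ?posrE// (lt_le_trans sz).
Qed.

Lemma invsqrt_series (R : realType) (z : R) : 0 <= z < 1 ->
  (\sum_(m <oo) (invsqrt_coef R m * z ^+ m)%:E = ((Num.sqrt (1 - z))^-1)%:E)%E.
Proof.
move=> z01; have /andP[z0 z1] := z01.
have sz : 0 < Num.sqrt (1 - z) by rewrite sqrtr_gt0 subr_gt0.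
pose P n := \sum_(0 <= m < n) invsqrt_coef R m * z ^+ m.
have cvgS : 1 - Num.sqrt (1 - z) * P n.+1 @[n --> \oo] --> (0 : R).
  apply/norm_cvg0P.
  apply: (@squeeze_cvgr _ _ _ _ (cst 0)
    (fun n => n.+1%:R * z ^+ n.+1 / Num.sqrt (1 - z))).
  - by apply: nearW => n; rewrite normr_ge0 invsqrt_partial_sum_bound.
  - exact: cvg_cst.
  - rewrite -[X in _ --> X](mul0r (Num.sqrt (1 - z))^-1).
    apply: cvgM; last exact: cvg_cst.
    by have := cvg_natmul_expr z01; rewrite -cvg_shiftS.
have cvgP : P @ \oo --> (Num.sqrt (1 - z))^-1.
  rewrite -cvg_shiftS (_ : (fun n => _) = fun n => (Num.sqrt (1 - z))^-1 *
    (1 - (1 - Num.sqrt (1 - z) * P n.+1))); last first.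
    by apply/funext => n; field; rewrite gt_eqF.
  suff : (Num.sqrt (1 - z))^-1 * (1 - (1 - Num.sqrt (1 - z) * P n.+1))
      @[n --> \oo] --> (Num.sqrt (1 - z))^-1 * (1 - 0) by rewrite subr0 mulr1.
  apply: cvgM; first exact: cvg_cst.
  by apply: cvgB => //; exact: cvg_cst.
apply/cvg_lim => //; apply: cvg_trans (cvg_EFin _ (f := EFin \o P) cvgP).
  by apply: near_eq_cvg; apply: nearW => n /=; rewrite /P -sumEFin.
exact: nearW.
Qed.

(** * The Lauricella series as an integral *)

(** Enumerating the index type reduces a sum over tuples to an ordinary series,
    to which scaling and term-by-term integration apply. *)
Lemma esum_countType (R : realType) (T : countType) (a : T -> \bar R) :
  (forall t, 0 <= a t)%E ->
  (\esum_(t in [set: T]) a t = \sum_(k <oo) oapp a 0 (@pickle_inv T k))%E.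
Proof.
move=> a0; set b := fun k => oapp a 0%E (@pickle_inv T k).
have b0 k : (0 <= b k)%E by rewrite /b; case: pickle_inv => /=.
rewrite nneseries_esumT//.
transitivity (\esum_(k in pickle @` [set: T]) b k)%E.
  rewrite esum_image; last by move=> s t _ _; exact: (pcan_inj pickleK).
  by apply: eq_esum => t _; rewrite /b pickleK_inv.
rewrite esum_mkcond; apply: eq_esum => k _; case: ifPn => //.
rewrite /b notin_setE/= => kT; case E : (@pickle_inv T k) => [t|//].
by exfalso; apply: kT; exists t => //; have := @pickle_invK T k; rewrite E.
Qed.

Lemma integral_esum d (X : measurableType d) (R : realType)
    (mu : {measure set X -> \bar R}) (D : set X) (T : countType)
    (f : T -> X -> \bar R) :
  measurable D -> (forall t, measurable_fun D (f t)) ->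
  (forall t x, D x -> 0 <= f t x)%E ->
  (\int[mu]_(x in D) (\esum_(t in [set: T]) f t x) =
   \esum_(t in [set: T]) \int[mu]_(x in D) f t x)%E.
Proof.
move=> mD mf f0.
rewrite esum_countType; last by move=> t; apply: integral_ge0 => x; exact: f0.
transitivity (\int[mu]_(x in D)
    \sum_(k <oo) oapp (f ^~ x) 0 (@pickle_inv T k))%E.
  by apply: eq_integral => x /[!inE] Dx; apply: esum_countType => t; exact: f0.
rewrite integral_nneseries//.
- apply: eq_eseriesr => k _; case: pickle_inv => //=.
  exact: integral0.
- by move=> k; case: pickle_inv => [t|] /=; [exact: mf|exact: measurable_cst].
- by move=> k x Dx; case: pickle_inv => //= t; exact: f0.
Qed.

(** Splitting off the first index turns the sum over (n+1)-tuples into an iterated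
    sum.  The constant c is carried along so that the induction hypothesis
    absorbs the factor of the index that was split off. *)
Lemma esum_tuple_prod (R : realType) n (c : R) (f : 'I_n -> nat -> R)
    (s : 'I_n -> R) :
  0 <= c -> (forall i k, 0 <= f i k) ->
  (forall i, \sum_(k <oo) (f i k)%:E = (s i)%:E)%E ->
  (\esum_(m in [set: n.-tuple nat]) (c * \prod_i f i (tnth m i))%:E =
   (c * \prod_i s i)%:E)%E.
Proof.
elim: n c f s => [|n IH] c f s c0 f0 fs.
  rewrite (_ : [set: _] = [set [tuple]]); last first.
    by apply/seteqP; split => // t _; rewrite [t]tuple0.
  by rewrite esum_set1 !big_ord0 ?mulr1.
pose e (p : nat * n.-tuple nat) : n.+1.-tuple nat := [tuple of p.1 :: p.2].
rewrite (@reindex_esum _ _ _ ([set: nat] `*`` (fun=> [set: n.-tuple nat]))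
  setT e); last first.
  split => //.
  - move=> [k t] [l u] _ _ /(congr1 val)/= [-> tu].
    by congr pair; exact: val_inj.
  - move=> t _; exists (thead t, [tuple of behead t]) => //.
    by rewrite [RHS]tuple_eta.
pose g (k : nat) (t : n.-tuple nat) :=
  (c * f ord0 k * \prod_i f (lift ord0 i) (tnth t i))%:E.
transitivity (\esum_(p in [set: nat] `*`` (fun=> [set: n.-tuple nat]))
    g p.1 p.2)%E.
  apply: eq_esum => p _; rewrite /g big_ord_recl tnth0 mulrA.
  by congr (_ * _)%:E; apply: eq_bigr => i _; rewrite tnthS.
rewrite -esum_esum; last first.
  by move=> k t _ _; rewrite lee_fin !mulr_ge0// prodr_ge0.
rewrite (eq_esum (b := fun k => ((c * \prod_i s (lift ord0 i))%:E *
    (f ord0 k)%:E)%E)); last first.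
  move=> k _; rewrite /g (IH _ (fun i => f (lift ord0 i))
    (fun i => s (lift ord0 i)))//.
  - by rewrite -EFinM mulrAC.
  - exact: mulr_ge0.
rewrite -nneseries_esumT; last first.
  move=> k; rewrite -EFinM lee_fin !mulr_ge0// prodr_ge0// => i _.
  rewrite -lee_fin -fs; apply: nneseries_ge0 => l _ _.
  by rewrite lee_fin.
rewrite nneseriesZl ?fs; last by move=> k _; rewrite lee_fin.
by rewrite -EFinM big_ord_recl mulrAC mulrA.
Qed.

Lemma unordered_sum_ge0 (R : realType) (I : choiceType) (f : I -> R) :
  (forall i, 0 <= f i) ->
  unordered_sum f = fine (\esum_(i in [set: I]) (f i)%:E)%E.
Proof.
move=> f0; congr fine; rewrite [X in (_ - X)%E]esum1 ?sube0.
  by apply: eq_esum => i _; rewrite funeposE/= max_l// lee_fin.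
by move=> i _; rewrite funenegE/= max_r// lee_fin oppr_le0.
Qed.

Lemma sin2_01 (R : realType) (t : R) : 0 <= sin t ^+ 2 <= 1.
Proof. by rewrite sqr_ge0/= -(cos2Dsin2 t) lerDr sqr_ge0. Qed.

(** Each term of the multiple series is a Wallis integral with exponent
    2 (m_1 + ... + m_n) + 4; all terms are nonnegative, so the sum may be taken
    under the integral, where it factors into binomial series in
    x_i sin^2 t. *)
Lemma lauricellaD_integral (R : realType) n (beta x : n.-tuple R) :
  (forall i, tnth beta i = 1 / 2) -> (forall i, 0 <= tnth x i < 1) ->
  lauricellaD (5 / 2) beta 3 x = 16 / (3 * pi) *
    \int[lebesgue_measure]_(t in `[0, pi / 2])
      (sin t ^+ 4 * \prod_i (Num.sqrt (1 - tnth x i * sin t ^+ 2))^-1).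
Proof.
move=> betaE x01.
have pi0 := @pi_gt0 R; have pin0 : pi != 0 :> R by rewrite gt_eqF.
have C0 : 0 <= 16 / (3 * pi) :> R by rewrite divr_ge0// mulr_ge0// ltW.
pose C : R := 16 / (3 * pi).
pose h (m : n.-tuple nat) (t : R) := C * sin t ^+ 4 *
  \prod_i (invsqrt_coef R (tnth m i) * (tnth x i * sin t ^+ 2) ^+ tnth m i).
have h0 m t : 0 <= h m t.
  apply: mulr_ge0; first by rewrite mulr_ge0// exprn_even_ge0.
  apply: prodr_ge0 => i _.
  have /andP[xi0 _] := x01 i.
  by rewrite mulr_ge0 ?invsqrt_coef_ge0// exprn_ge0// mulr_ge0// sqr_ge0.
pose p (m : n.-tuple nat) :=
  \prod_i (invsqrt_coef R (tnth m i) * tnth x i ^+ tnth m i).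
pose N (m : n.-tuple nat) := (\sum_(i < n) tnth m i)%N.
have hE m t : h m t = C * p m * sin t ^+ (N m).+2.*2.
  rewrite /h /p -[LHS]mulrA -[RHS]mulrA; congr (_ * _).
  rewrite (_ : (N m).+2.*2 = (4 + N m * 2)%N); last by rewrite -addn2 doubleD addnC muln2.
  rewrite exprD [RHS]mulrCA; congr (_ * _); rewrite mulnC exprM /N expr_sum.
  rewrite -big_split/=; apply: eq_bigr => i _.
  by rewrite exprMn mulrA.
have ch m : continuous (h m).
  by rewrite (funext (hE m)) => t; smooth.
have termE m : (lauricellaD_term (5 / 2) beta 3 x m)%:E =
    (\int[lebesgue_measure]_(t in `[0%R, (pi / 2)%R]) (h m t)%:E)%E.
  transitivity (\int[lebesgue_measure]_(t in `[0, pi / 2]) h m t)%:E; last first.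
    rewrite fineK//; apply: integrable_fin_num => //.
    exact: continuous_integrable_itv.
  rewrite [in RHS](_ : h m = fun t => C * p m * sin t ^+ (N m).+2.*2); last first.
    by apply/funext => t; exact: hE.
  rewrite RintegralZl//; last first.
    by apply: continuous_integrable_itv => t; smooth.
  rewrite integral_sin_even /lauricellaD_term pochhammer_ratio -/(N m) /p.
  rewrite (eq_bigr (fun i => invsqrt_coef R (tnth m i) * tnth x i ^+ tnth m i)).
    move: (\prod_i _) (invsqrt_coef _ _) => u v; rewrite /C; congr EFin.
    by move: (@pi R) pin0 => q q0; field.
  by move=> i _; rewrite betaE.
rewrite /lauricellaD unordered_sum_ge0; last first.
  move=> m; rewrite -lee_fin termE; apply: integral_ge0 => t _.
  by rewrite lee_fin.
under eq_esum do rewrite termE.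
rewrite -integral_esum//; last 2 first.
- move=> m; apply/measurable_EFinP; apply: measurable_funTS.
  exact: continuous_measurable_fun.
- by move=> m t _; rewrite lee_fin.
pose F t := sin t ^+ 4 * \prod_i (Num.sqrt (1 - tnth x i * sin t ^+ 2))^-1.
have z01 i t : 0 <= tnth x i * sin t ^+ 2 < 1.
  have /andP[xi0 xi1] := x01 i; rewrite mulr_ge0 ?sqr_ge0//=.
  have /andP[_ s1] := sin2_01 t.
  by apply: le_lt_trans xi1; exact: ler_piMr.
transitivity (\int[lebesgue_measure]_(t in `[0, pi / 2]) (C * F t)).
  congr fine; apply: eq_integral => t _.
  rewrite /h (@esum_tuple_prod _ _ _
    (fun i k => invsqrt_coef R k * (tnth x i * sin t ^+ 2) ^+ k)
    (fun i => (Num.sqrt (1 - tnth x i * sin t ^+ 2))^-1)).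
  - by rewrite /F mulrA.
  - by rewrite mulr_ge0// exprn_even_ge0.
  - move=> i k; have /andP[z0 _] := z01 i t.
    by rewrite mulr_ge0 ?invsqrt_coef_ge0// exprn_ge0.
  - by move=> i; exact: invsqrt_series.
rewrite RintegralZl//; apply: continuous_integrable_itv => t.
apply: (continuousM (s := fun u : R => sin u ^+ 4)
  (t := fun u : R => \prod_i (Num.sqrt (1 - tnth x i * sin u ^+ 2))^-1)).
  by smooth.
apply: continuous_big t => [|i _ t]; first exact: mul_continuous.
have /andP[_ zlt1] := z01 i t; have pos : 0 < 1 - tnth x i * sin t ^+ 2.
  by rewrite subr_gt0.
by smooth => //; rewrite gt_eqF// sqrtr_gt0.
Qed.

(** * The Landen-type substitutions *)

(** Of degree four in S, where s = S^2.  The substitutions below give 1 - k^2 y^2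
    this same numerator for both moduli k. *)
Definition quartic (R : realType) (a b s : R) : R :=
  (b ^+ 2 - a ^+ 2 * s) * (b ^+ 2 - s / a ^+ 2).

Definition angle_radical (R : realType) (a b t : R) : R :=
  Num.sqrt ((b ^+ 4 - sin t ^+ 2) * quartic a b (sin t ^+ 2)).

Definition landen (R : realType) (b e t : R) : R :=
  (b ^+ 2 - e) * sin t / (b ^+ 2 - e * sin t ^+ 2).

(** The two moduli of the theorem are the cases e = 1 and e = -1. *)
Definition landen_modulus (R : realType) (a b e : R) : R :=
  (a ^+ 2 - e) * b / (a * (b ^+ 2 - e)).

Definition landen_der (R : realType) (b e t : R) : R :=
  (b ^+ 2 - e) * cos t * (b ^+ 2 + e * sin t ^+ 2)
  / (b ^+ 2 - e * sin t ^+ 2) ^+ 2.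

Lemma quartic_gt0 (R : realType) (a b s : R) : 1 < a -> a < b ->
  0 <= s <= 1 -> 0 < quartic a b s.
Proof.
move=> a1 ab /andP[s0 s1]; have b1 := lt_trans a1 ab.
have a2 : 1 < a ^+ 2 by rewrite exprn_egt1.
have b2 : a ^+ 2 < b ^+ 2 by rewrite ltrXn2r// ?nnegrE; lra.
rewrite mulr_gt0// subr_gt0.
  by apply: le_lt_trans b2; rewrite ler_piMr// sqr_ge0.
rewrite ltr_pdivrMr; last by rewrite exprn_gt0//; lra.
nra.
Qed.

Lemma angle_radicand_gt0 (R : realType) (a b t : R) : 1 < a -> a < b ->
  0 < (b ^+ 4 - sin t ^+ 2) * quartic a b (sin t ^+ 2).
Proof.
move=> a1 ab; rewrite mulr_gt0 ?quartic_gt0 ?sin2_01// subr_gt0.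
have /andP[_ s1] := sin2_01 t.
by apply: le_lt_trans s1 _; rewrite exprn_egt1//; exact: lt_trans ab.
Qed.

Lemma angle_radical_gt0 (R : realType) (a b t : R) : 1 < a -> a < b ->
  0 < angle_radical a b t.
Proof. by move=> a1 ab; rewrite sqrtr_gt0 angle_radicand_gt0. Qed.

Lemma landen_den_gt0 (R : realType) (b e s : R) : 1 < b -> e ^+ 2 = 1 ->
  0 <= s <= 1 -> 0 < b ^+ 2 - e * s.
Proof.
move=> b1 /eqP; rewrite sqrf_eq1 => /orP[]/eqP-> /andP[s0 s1].
- by rewrite mul1r subr_gt0 (le_lt_trans s1)// exprn_egt1.
- by rewrite mulN1r opprK ltr_pwDl// exprn_gt0// (lt_trans ltr01).
Qed.

Lemma landen_derive (R : realType) (b e t : R) : 1 < b -> e ^+ 2 = 1 ->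
  is_derive t 1 (landen b e) (landen_der b e t).
Proof.
move=> b1 e2; have d0 := landen_den_gt0 b1 e2 (sin2_01 t).
rewrite /landen; derive_eq; first by rewrite gt_eqF.
by rewrite /landen_der /=; field; rewrite gt_eqF.
Qed.

(** The numerator (b^2 - e s)^2 - (b^2 - e)^2 s, where s = sin^2 t, factors as
    (1 - s) (b^4 - e^2 s). *)
Lemma landen_co (R : realType) (b e t : R) : 1 < b -> e ^+ 2 = 1 ->
  1 - landen b e t ^+ 2 = cos t ^+ 2 * (b ^+ 4 - sin t ^+ 2)
    / (b ^+ 2 - e * sin t ^+ 2) ^+ 2.
Proof.
move=> b1 e2; have d0 := landen_den_gt0 b1 e2 (sin2_01 t).
rewrite /landen cos2sin2; move: (sin t) d0 => s d0.
apply: (@mulIf _ ((b ^+ 2 - e * s ^+ 2) ^+ 2)); first by rewrite gt_eqF// exprn_gt0.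
rewrite divfK ?gt_eqF ?exprn_gt0//.
transitivity (b ^+ 4 - (b ^+ 4 + e ^+ 2) * s ^+ 2 + e ^+ 2 * s ^+ 4).
  by field; rewrite gt_eqF.
by rewrite e2; ring.
Qed.

(** After expansion only e^2 remains, so the numerator is the same for the two
    signs of e; this is why both moduli lead to one radical. *)
Lemma landen_modulus_co (R : realType) (a b e t : R) :
  1 < a -> 1 < b -> e ^+ 2 = 1 ->
  1 - landen_modulus a b e ^+ 2 * landen b e t ^+ 2 =
  quartic a b (sin t ^+ 2) / (b ^+ 2 - e * sin t ^+ 2) ^+ 2.
Proof.
move=> a1 b1 e2; have d0 := landen_den_gt0 b1 e2 (sin2_01 t).
have be0 : 0 < b ^+ 2 - e.
  by have := landen_den_gt0 b1 e2 (s := 1); rewrite mulr1 ler01 lexx; exact.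
have a0 : a != 0 by rewrite gt_eqF// (lt_trans ltr01).
rewrite /landen /landen_modulus /quartic; move: (sin t) d0 => s d0.
apply: (@mulIf _ ((b ^+ 2 - e * s ^+ 2) ^+ 2)); first by rewrite gt_eqF// exprn_gt0.
rewrite divfK ?gt_eqF ?exprn_gt0//.
transitivity (b ^+ 4 + e ^+ 2 * s ^+ 4
    - (a ^+ 2 + e ^+ 2 / a ^+ 2) * b ^+ 2 * s ^+ 2).
  by field; rewrite a0 !gt_eqF.
by rewrite e2; field.
Qed.

(** The map reaches y = 1 at t = pi/2, so the identity for 1 - k^2 y^2 evaluates
    1 - k^2 and shows that it is positive. *)
Lemma landen_modulus_lt1 (R : realType) (a b e y : R) : 1 < a -> a < b ->
  e ^+ 2 = 1 -> 0 <= y < 1 -> 0 < 1 - landen_modulus a b e ^+ 2 * y ^+ 2.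
Proof.
move=> a1 ab e2 /andP[y0 y1]; have b1 := lt_trans a1 ab.
have i01 : 0 <= (1 : R) <= 1 by rewrite ler01/=.
have be0 : 0 < b ^+ 2 - e.
  by have := landen_den_gt0 b1 e2 i01; rewrite mulr1.
have := landen_modulus_co (pi / 2) a1 b1 e2.
rewrite /landen sin_pihalf expr1n !mulr1 divff ?gt_eqF// expr1n mulr1 => k2.
have k21 : landen_modulus a b e ^+ 2 < 1.
  by rewrite -subr_gt0 k2 divr_gt0 ?quartic_gt0// exprn_gt0.
rewrite subr_gt0 (le_lt_trans _ k21)// ler_piMr ?sqr_ge0//.
by rewrite exprn_ile1// ltW.
Qed.

Lemma landen_substitution (R : realType) (b e : R) (G H : R -> R) :
  1 < b -> e ^+ 2 = 1 ->
  (forall y, 0 <= y < 1 -> {for y, continuous G}) ->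
  (forall y, 0 <= G y) -> continuous H ->
  (forall t, 0 < cos t -> G (landen b e t) * landen_der b e t = H t) ->
  \int[lebesgue_measure]_(y in `[0, 1]) G y =
  \int[lebesgue_measure]_(t in `[0, pi / 2]) H t.
Proof.
move=> b1 e2 cG G0 cH GH; have pih : 0 < pi / 2 :> R by rewrite divr_gt0// pi_gt0.
have den0 (s : R) : 0 <= s <= 1 -> 0 < b ^+ 2 - e * s by exact: landen_den_gt0.
have be0 : 0 < b ^+ 2 - e by rewrite -[e]mulr1 den0// ler01 lexx.
have landen0 : landen b e 0 = 0 by rewrite /landen sin0 mulr0 mul0r.
have landen1 : landen b e (pi / 2) = 1.
  by rewrite /landen sin_pihalf expr1n !mulr1 divff// gt_eqF.
have cos0_pi (t : R) : 0 <= t < pi / 2 -> 0 < cos t.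
  move=> /andP[t0 tpi]; apply: cos_gt0_pihalf; rewrite tpi andbT.
  by apply: lt_le_trans t0; rewrite oppr_lt0.
have := @improper_substitution _ _ _ (landen b e) (landen_der b e) G H pih.
rewrite landen0 landen1; apply.
- by move=> t; exact: landen_derive.
- move=> t; rewrite /landen_der; smooth.
  by rewrite gt_eqF// exprn_gt0// den0// sin2_01.
- move=> t /cos0_pi ct; rewrite divr_gt0 ?exprn_gt0 ?den0 ?sin2_01//.
  rewrite mulr_gt0 ?mulr_gt0// -[e]opprK mulNr landen_den_gt0 ?sin2_01//.
  by rewrite sqrrN.
- exact: cG.
- exact: G0.
- exact: cH.
- by move=> t /cos0_pi; exact: GH.
Qed.

Definition K_integrand (R : realType) (a b e t : R) : R :=
  (b ^+ 2 - e) * (b ^+ 2 + e * sin t ^+ 2) / angle_radical a b t.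

Definition E_integrand (R : realType) (a b e t : R) : R :=
  (b ^+ 2 - e) * (b ^+ 2 + e * sin t ^+ 2) * quartic a b (sin t ^+ 2)
  / ((b ^+ 2 - e * sin t ^+ 2) ^+ 2 * angle_radical a b t).

(** The factor cos t of the derivative of the map cancels the one coming from
    sqrt(1 - y^2), which removes the singularity at y = 1. *)
Lemma ellipticK_landen (R : realType) (a b e : R) : 1 < a -> a < b ->
  e ^+ 2 = 1 ->
  ellipticK (landen_modulus a b e) =
  \int[lebesgue_measure]_(t in `[0, pi / 2])
    K_integrand a b e t.
Proof.
move=> a1 ab e2; have b1 := lt_trans a1 ab.
apply: (landen_substitution b1 e2).
- move=> y y01; have k0 := landen_modulus_lt1 a1 ab e2 y01.
  have /andP[y0 y1] := y01.
  have pos : 0 < (1 - y ^+ 2) * (1 - landen_modulus a b e ^+ 2 * y ^+ 2).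
    by rewrite mulr_gt0// subr_gt0 exprn_ilt1.
  by smooth; rewrite // gt_eqF// sqrtr_gt0.
- by move=> y; rewrite invr_ge0 sqrtr_ge0.
- move=> t; have r0 := angle_radicand_gt0 t a1 ab.
  rewrite /K_integrand /angle_radical /quartic; smooth; last exact: r0.
  by rewrite gt_eqF// sqrtr_gt0.
- move=> t ct; have d0 := landen_den_gt0 b1 e2 (sin2_01 t).
  have r0 := angle_radical_gt0 t a1 ab.
  rewrite landen_co// landen_modulus_co//.
  rewrite (_ : _ * _ * _ / _ ^+ 2 * _ =
    (cos t / (b ^+ 2 - e * sin t ^+ 2) ^+ 2) ^+ 2 *
    ((b ^+ 4 - sin t ^+ 2) * quartic a b (sin t ^+ 2))).
    rewrite sqrtrM ?sqr_ge0// sqrtr_sqr -/(angle_radical a b t).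
    rewrite ger0_norm; last by rewrite divr_ge0 ?sqr_ge0// ltW.
    rewrite /landen_der /K_integrand; field.
    by rewrite !gt_eqF.
  by field; rewrite gt_eqF.
Qed.

Lemma ellipticE_landen (R : realType) (a b e : R) : 1 < a -> a < b ->
  e ^+ 2 = 1 ->
  ellipticE (landen_modulus a b e) =
  \int[lebesgue_measure]_(t in `[0, pi / 2])
    E_integrand a b e t.
Proof.
move=> a1 ab e2; have b1 := lt_trans a1 ab.
apply: (landen_substitution b1 e2).
- move=> y y01; have k0 := landen_modulus_lt1 a1 ab e2 y01.
  have /andP[y0 y1] := y01.
  have y20 : 0 < 1 - y ^+ 2 by rewrite subr_gt0 exprn_ilt1.
  by smooth; [exact: divr_gt0|rewrite gt_eqF].
- by move=> y; exact: sqrtr_ge0.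
- move=> t; have r0 := angle_radicand_gt0 t a1 ab.
  have d0 := landen_den_gt0 b1 e2 (sin2_01 t).
  rewrite /E_integrand /angle_radical /quartic; smooth; last exact: r0.
  by rewrite gt_eqF// mulr_gt0 ?exprn_gt0// sqrtr_gt0.
- move=> t ct; have d0 := landen_den_gt0 b1 e2 (sin2_01 t).
  have q0 := quartic_gt0 a1 ab (sin2_01 t).
  have r0 := angle_radical_gt0 t a1 ab.
  have rs0 : 0 < b ^+ 4 - sin t ^+ 2.
    by have := angle_radicand_gt0 t a1 ab; rewrite pmulr_lgt0.
  rewrite landen_co// landen_modulus_co//.
  rewrite (_ : quartic _ _ _ / _ / _ =
    (quartic a b (sin t ^+ 2) / cos t) ^+ 2 /
    ((b ^+ 4 - sin t ^+ 2) * quartic a b (sin t ^+ 2))).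
    rewrite sqrtrM ?sqr_ge0// sqrtr_sqr sqrtrV; last by rewrite mulr_ge0// ltW.
    rewrite -/(angle_radical a b t) ger0_norm; last by rewrite divr_ge0// ltW.
    rewrite /landen_der /E_integrand; field.
    by rewrite !gt_eqF.
  by field; rewrite !gt_eqF.
Qed.

(** * The exact differential comparing the integrals *)

Lemma angle_radical_derive (R : realType) (a b t : R) : 1 < a -> a < b ->
  is_derive t 1 (angle_radical a b)
    (sin t * cos t *
     (- quartic a b (sin t ^+ 2) - (b ^+ 4 - sin t ^+ 2) *
        (a ^+ 2 * (b ^+ 2 - sin t ^+ 2 / a ^+ 2)
         + (b ^+ 2 - a ^+ 2 * sin t ^+ 2) / a ^+ 2)) / angle_radical a b t).
Proof.
move=> a1 ab; have r0 := angle_radicand_gt0 t a1 ab.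
have := angle_radical_gt0 t a1 ab.
rewrite {2 3}/angle_radical /quartic => R0.
rewrite /angle_radical /quartic in r0 R0 *.
derive_eq; first exact: r0.
have a0 : a != 0 by rewrite gt_eqF// (lt_trans ltr01).
move: (Num.sqrt _) R0 => r R0 /=; field.
by rewrite a0 gt_eqF.
Qed.

(** With q = b / S - S / b and p = b / S + S / b, the differential S^2 dS splits
    into multiples of (p^2 - 1) dp and (q^2 + 1) dq, and up to a power of S the
    radical cos t sqrt(P) is a function of p^2 alone, and also of q^2 alone.
    Reducing either part to integrals of the
    first and second kind leaves a boundary term; each of the two boundary terms
    diverges at S = 0, but their difference is, up to the factor b, the primitive
    below. *)
Lemma boundary_derive (R : realType) (a b t : R) : 1 < a -> a < b ->
  is_derive t 1
    (fun t => 2 * sin t * cos t * angle_radical a b t / (b ^+ 4 - sin t ^+ 4))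
    ((b ^+ 4 - b ^+ 2 + 1) / (b ^+ 2 - 1) * K_integrand a b 1 t
     - (b ^+ 4 + b ^+ 2 + 1) / (1 + b ^+ 2) * K_integrand a b (-1) t
     + (1 - b ^+ 2) * E_integrand a b 1 t
     + (1 + b ^+ 2) * E_integrand a b (-1) t
     - 2 * (sin t ^+ 4 / angle_radical a b t)).
Proof.
move=> a1 ab; have b1 := lt_trans a1 ab.
have r0 := angle_radicand_gt0 t a1 ab.
have rE : angle_radical a b t ^+ 2 =
    (b ^+ 4 - sin t ^+ 2) * quartic a b (sin t ^+ 2) by rewrite sqr_sqrtr// ltW.
have R0 := angle_radical_gt0 t a1 ab.
have s01 := sin2_01 t.
have m0 : b ^+ 2 - sin t ^+ 2 != 0.
  have := landen_den_gt0 b1 (expr1n _ 2) s01.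
  by rewrite mul1r => h; rewrite gt_eqF.
have p0 : b ^+ 2 + sin t ^+ 2 != 0.
  have e2 : (-1) ^+ 2 = 1 :> R by rewrite sqrrN expr1n.
  have := landen_den_gt0 b1 e2 s01.
  by rewrite mulN1r opprK => h; rewrite gt_eqF.
have d4 : b ^+ 4 - sin t ^+ 4 = (b ^+ 2 - sin t ^+ 2) * (b ^+ 2 + sin t ^+ 2).
  by ring.
have d0 : b ^+ 4 - sin t ^+ 4 != 0 by rewrite d4 mulf_neq0.
have bm : b ^+ 2 - 1 != 0 by rewrite subr_eq0 gt_eqF// exprn_egt1.
have bp : 1 + b ^+ 2 != 0 by rewrite gt_eqF// ltr_pwDl// sqr_ge0.
have a0 : a != 0 by rewrite gt_eqF// (lt_trans ltr01).
derive_eq; [exact: angle_radical_derive|exact: d0|].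
rewrite /= d4 /K_integrand /E_integrand.
have := cos2sin2 t; have rn0 : angle_radical a b t != 0 by rewrite gt_eqF.
move: (angle_radical a b t) rE rn0 m0 p0 => r rE rn0.
move: (sin t) (cos t) rE => s c rE m0 p0 cE.
rewrite !mulN1r !opprK !mul1r [b ^+ 2 + 1]addrC.
(* times the radical, both sides involve only its square and that of cos t *)
apply: (mulIf rn0); set p := - _ - _ * _.
transitivity ((2 * (c ^+ 2 - s ^+ 2) * r ^+ 2 + 2 * s ^+ 2 * c ^+ 2 * p)
    / ((b ^+ 2 - s ^+ 2) * (b ^+ 2 + s ^+ 2))
  + 8 * s ^+ 4 * c ^+ 2 * r ^+ 2
    / ((b ^+ 2 - s ^+ 2) * (b ^+ 2 + s ^+ 2)) ^+ 2).
  by move: p => p; field; rewrite m0 p0.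
rewrite rE cE /p /quartic; field.
by rewrite a0 rn0 m0 p0 bm bp.
Qed.

Lemma K_integrand_continuous (R : realType) (a b e : R) : 1 < a -> a < b ->
  continuous (K_integrand a b e).
Proof.
move=> a1 ab t; have r0 := angle_radical_gt0 t a1 ab.
rewrite /K_integrand; smooth; first by rewrite gt_eqF.
exact: angle_radical_derive.
Qed.

Lemma E_integrand_continuous (R : realType) (a b e : R) : 1 < a -> a < b ->
  e ^+ 2 = 1 -> continuous (E_integrand a b e).
Proof.
move=> a1 ab e2 t; have r0 := angle_radical_gt0 t a1 ab.
have d0 := landen_den_gt0 (lt_trans a1 ab) e2 (sin2_01 t).
rewrite /E_integrand /quartic; smooth; last exact: angle_radical_derive.
by rewrite gt_eqF// mulr_gt0// exprn_gt0.
Qed.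

Lemma sin4_integrand_continuous (R : realType) (a b : R) : 1 < a -> a < b ->
  continuous (fun t : R => sin t ^+ 4 / angle_radical a b t).
Proof.
move=> a1 ab t; have r0 := angle_radical_gt0 t a1 ab.
smooth; first by rewrite gt_eqF.
exact: angle_radical_derive.
Qed.

Lemma elliptic_combination (R : realType) (a b : R) : 1 < a -> a < b ->
  (b ^+ 4 - b ^+ 2 + 1) / (b ^+ 2 - 1) * ellipticK (landen_modulus a b 1)
  - (b ^+ 4 + b ^+ 2 + 1) / (1 + b ^+ 2) * ellipticK (landen_modulus a b (-1))
  + (1 - b ^+ 2) * ellipticE (landen_modulus a b 1)
  + (1 + b ^+ 2) * ellipticE (landen_modulus a b (-1))
  = 2 * \int[lebesgue_measure]_(t in `[0, pi / 2])
          (sin t ^+ 4 / angle_radical a b t).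
Proof.
move=> a1 ab; have pih : 0 < pi / 2 :> R by rewrite divr_gt0// pi_gt0.
have e1 : 1 ^+ 2 = 1 :> R by rewrite expr1n.
have e2 : (-1) ^+ 2 = 1 :> R by rewrite sqrrN expr1n.
rewrite !ellipticK_landen// !ellipticE_landen//.
have cK1 := K_integrand_continuous (e := 1) a1 ab.
have cK2 := K_integrand_continuous (e := -1) a1 ab.
have cE1 := E_integrand_continuous a1 ab e1.
have cE2 := E_integrand_continuous a1 ab e2.
have cS := sin4_integrand_continuous a1 ab.
have cZ (k : R) (f : R -> R) : continuous f -> continuous (fun t => k * f t).
  by move=> cf t; apply: cvgM; [exact: cvg_cst|exact: cf].
have cD (f g : R -> R) : continuous f -> continuous g ->
    continuous (fun t => f t + g t).
  by move=> cf cg t; apply: cvgD; [exact: cf|exact: cg].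
have cB (f g : R -> R) : continuous f -> continuous g ->
    continuous (fun t => f t - g t).
  by move=> cf cg t; apply: cvgB; [exact: cf|exact: cg].
have iK1 := continuous_integrable_itv 0 (pi / 2) cK1.
have iK2 := continuous_integrable_itv 0 (pi / 2) cK2.
have iE1 := continuous_integrable_itv 0 (pi / 2) cE1.
have iE2 := continuous_integrable_itv 0 (pi / 2) cE2.
have iS := continuous_integrable_itv 0 (pi / 2) cS.
rewrite -!RintegralZl//.
rewrite -RintegralB//; [|by apply: continuous_integrable_itv; exact: cZ..].
rewrite -RintegralD//; [|apply: continuous_integrable_itv..]; last 2 first.
- by apply: (cB); exact: cZ.
- exact: cZ.
rewrite -RintegralD//; [|apply: continuous_integrable_itv..]; last 2 first.
- by apply: (cD); [apply: (cB)|]; exact: cZ.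
- exact: cZ.
apply/eqP; rewrite -subr_eq0; apply/eqP.
rewrite -RintegralB//; [|apply: continuous_integrable_itv..]; last 2 first.
- by apply: (cD); [apply: (cD); [apply: (cB)|]|]; exact: cZ.
- exact: cZ.
rewrite (Rintegral_is_derive pih _ (fun t => boundary_derive t a1 ab)).
  by rewrite sin0 cos_pihalf !mulr0 !mul0r subrr.
by apply: (cB); [apply: (cD); [apply: (cD); [apply: (cB)|]|]|]; exact: cZ.
Qed.

(** The radical is at most b^4, so the integral is at least a Wallis integral
    divided by b^4. *)
Lemma sin4_integral_gt0 (R : realType) (a b : R) : 1 < a -> a < b ->
  0 < \int[lebesgue_measure]_(t in `[0, pi / 2])
        (sin t ^+ 4 / angle_radical a b t).
Proof.
move=> a1 ab; have b1 := lt_trans a1 ab.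
have b40 : 0 < b ^+ 4 by rewrite exprn_gt0// (lt_trans ltr01).
have csin4 : continuous (fun t : R => (b ^+ 4)^-1 * sin t ^+ 2.*2).
  by move=> t; smooth.
have csin : continuous (fun t : R => sin t ^+ 2.*2) by move=> t; smooth.
apply: (@lt_le_trans _ _ (\int[lebesgue_measure]_(t in `[0, pi / 2])
    ((b ^+ 4)^-1 * sin t ^+ 2.*2))).
  rewrite RintegralZl//; last exact: continuous_integrable_itv.
  rewrite integral_sin_even mulr_gt0 ?invr_gt0//.
  by rewrite mulr_gt0 ?invsqrt_coef_gt0// divr_gt0// pi_gt0.
apply: le_Rintegral => //.
- exact: continuous_integrable_itv.
- by apply: continuous_integrable_itv; exact: sin4_integrand_continuous.
- move=> t _; rewrite mulrC ler_wpM2l ?exprn_even_ge0//.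
  have r0 := angle_radical_gt0 t a1 ab.
  rewrite lef_pV2 ?posrE// -(ger0_norm (ltW b40)) -sqrtr_sqr /angle_radical.
  rewrite ler_sqrt ?sqr_ge0//.
  have /andP[s0 s1] := sin2_01 t.
  have a20 : 0 < a ^+ 2 by rewrite exprn_gt0// (lt_trans ltr01).
  have q0 := ltW (quartic_gt0 a1 ab (sin2_01 t)).
  rewrite [leRHS]expr2; apply: ler_pM => //.
  + by rewrite subr_ge0 (le_trans s1)// exprn_ege1// ltW.
  + by rewrite gerBl.
  rewrite -subr_ge0 (_ : _ - _ = sin t ^+ 2 *
      ((a ^+ 2 * b ^+ 2 - sin t ^+ 2) + b ^+ 2 / a ^+ 2)); last first.
    by rewrite /quartic; field; rewrite gt_eqF// (lt_trans ltr01).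
  rewrite mulr_ge0// addr_ge0//; last by rewrite divr_ge0// sqr_ge0.
  by rewrite subr_ge0 (le_trans s1)// mulr_ege1// exprn_ege1// ltW.
Qed.

(** * The formula for pi *)

Theorem theorem5p2 (R : realType) (a b : R) (ha : 1 < a) (hab : a < b) :
  let k1 : R := (a ^+ 2 - 1) * b / (a * (b ^+ 2 - 1)) in
  let k2 : R := (a ^+ 2 + 1) * b / (a * (1 + b ^+ 2)) in
  let KK : R :=
    (b ^+ 4 - b ^+ 2 + 1) / (b ^+ 2 - 1) * ellipticK k1
    - (b ^+ 4 + b ^+ 2 + 1) / (1 + b ^+ 2) * ellipticK k2 in
  let EE : R :=
    (1 - b ^+ 2) * ellipticE k1 + (1 + b ^+ 2) * ellipticE k2 in
  let FF : R :=
    lauricellaD (5 / 2) [tuple 1 / 2; 1 / 2; 1 / 2] 3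
      [tuple a ^+ 2 / b ^+ 2; 1 / (a ^+ 2 * b ^+ 2); 1 / b ^+ 4] in
  pi = 8 / 3 * b ^+ 4 * ((KK + EE) / FF).
Proof.
have a0 : 0 < a := lt_trans ltr01 ha.
have b1 := lt_trans ha hab; have b0 : 0 < b := lt_trans ltr01 b1.
move=> k1 k2 KK EE FF.
set J := \int[lebesgue_measure]_(t in `[0, pi / 2 : R])
  (sin t ^+ 4 / angle_radical a b t).
have J0 : 0 < J by exact: sin4_integral_gt0.
have k2E : k2 = landen_modulus a b (-1).
  by rewrite /k2 /landen_modulus !opprK [1 + _]addrC.
have numE : KK + EE = 2 * J.
  by rewrite -elliptic_combination// -k2E /KK /EE addrA.
pose x1 : R := a ^+ 2 / b ^+ 2; pose x2 : R := 1 / (a ^+ 2 * b ^+ 2).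
pose x3 : R := 1 / b ^+ 4.
have x1_01 : 0 <= x1 < 1.
  rewrite /x1 divr_ge0 ?sqr_ge0//= ltr_pdivrMr ?exprn_gt0// mul1r.
  by rewrite ltrXn2r// ?nnegrE ltW.
have x2_01 : 0 <= x2 < 1.
  have ab2 : 1 < a ^+ 2 * b ^+ 2 by rewrite mulr_egt1// exprn_egt1.
  have ab0 : 0 < a ^+ 2 * b ^+ 2 by rewrite (lt_trans ltr01).
  by rewrite /x2 div1r invr_ge0 (ltW ab0) invf_lt1.
have x3_01 : 0 <= x3 < 1.
  have b40 : 0 < b ^+ 4 by rewrite exprn_gt0.
  by rewrite /x3 div1r invr_ge0 (ltW b40) invf_lt1// exprn_egt1.
have radicalE t : Num.sqrt (1 - x1 * sin t ^+ 2) *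
    (Num.sqrt (1 - x2 * sin t ^+ 2) * Num.sqrt (1 - x3 * sin t ^+ 2)) =
    angle_radical a b t / b ^+ 4.
  have factor_ge0 x : 0 <= x < 1 -> 0 <= 1 - x * sin t ^+ 2.
    move=> /andP[x0 x1']; have /andP[s0 s1] := sin2_01 t.
    by rewrite subr_ge0 mulr_ile1// ltW.
  rewrite -sqrtrM ?factor_ge0// -sqrtrM ?factor_ge0//.
  have -> : b ^+ 4 = Num.sqrt ((b ^+ 4) ^+ 2).
    by rewrite sqrtr_sqr ger0_norm// exprn_ge0// ltW.
  rewrite /angle_radical -sqrtrV ?sqr_ge0// -sqrtrM; last first.
    exact/ltW/angle_radicand_gt0.
  by congr Num.sqrt; rewrite /x1 /x2 /x3 /quartic; field; rewrite !gt_eqF.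
have FFE : FF = 16 / (3 * pi) * (b ^+ 4 * J).
  rewrite /FF lauricellaD_integral.
  - congr (_ * _); rewrite -RintegralZl//; last first.
      by apply: continuous_integrable_itv; exact: sin4_integrand_continuous.
    apply: eq_Rintegral => t _; rewrite [RHS]mulrCA; congr (_ * _).
    rewrite !big_ord_recl big_ord0 mulr1 !(tnth_nth 0)/=.
    by rewrite -!invfM radicalE invf_div.
  - by case=> [[|[|[|]]]].
  - by case=> [[|[|[|]]]].
rewrite numE FFE; move: (@pi R) (@pi_gt0 R) J J0 {numE FFE} => p p0 J J0; field.
by rewrite !gt_eqF.
Qed.
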